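(* Let $p$ be a prime, $i\ge1$ an integer and $q=p^{2i}$. Let $H=\langle h\rangle$ with $h=\alpha^{p^{2i}+p^i+1}$, a group of order $p^{2i}-p^i+1$ of $\mathbb K$-automorphisms of $\mathbb K(\mathcal X_q)$. Then the quotient curve $\mathcal X_q/H$ is isomorphic to the curve $\mathcal X_{p^i}$ given by the equation $$XY^{p^i+1}+X^{p^i+1}+Y=0 .$$
   Context: $\mathbb K$ is the algebraic closure of $\mathbb F_q$. For a prime power $r$, the Pellikaan curve $\mathcal X_r$ is the plane curve over $\mathbb K$ with affine equation $XY^{r+1}+X^{r+1}+Y=0$. The function field of $\mathcal X_q$ is $\mathbb K(\mathcal X_q)=\mathbb K(x,y)$ with $xy^{q+1}+x^{q+1}+y=0$. Let $\lambda\in\mathbb K$ be a primitive $(q^2+q+1)$-th root of unity, and let $\alpha$ be the $\mathbb K$-automorphism of $\mathbb K(\mathcal X_q)$, of order $q^2+q+1=(p^{2i}+p^i+1)(p^{2i}-p^i+1)$, defined by $\alpha(x)=\lambda x$, $\alpha(y)=\lambda^{q+1}y$. The quotient curve $\mathcal X_q/H$ is the curve whose function field is the fixed field $\mathbb K(x,y)^H$; two curves are isomorphic here when their function fields are $\mathbb K$-isomorphic. *)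

(* Defs.v *)
From HB Require Import structures.
From mathcomp Require Import all_boot all_order all_algebra.
From mathcomp Require Import boolp classical_sets functions cardinality.

Set Implicit Arguments.
Unset Strict Implicit.
Unset Printing Implicit Defensive.

Import GRing.Theory.
Local Open Scope ring_scope.

Definition is_algebraic_closure (F : fieldType) (K : closedFieldType)
    (iF : {rmorphism F -> K}) : Prop :=
  forall a : K, algebraicOver iF a.

(* In {poly {poly K}}, 'X is the outer variable and 'Y = 'X%:P the inner one,
   so that P.[x, y] substitutes x for 'X and y for 'Y. *)
Definition pellikaan (K : fieldType) (r : nat) : {poly {poly K}} :=
  'X * 'Y ^+ r.+1 + 'X ^+ r.+1 + 'Y.

Definition eval2 (K L : fieldType) (iL : {rmorphism K -> L}) (x y : L)
    (P : {poly {poly K}}) : L :=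
  (map_poly (map_poly iL) P).[x, y].

(* (L, x, y) is a copy of Frac(K[X, Y] / (f)): the polynomial relations
   between x and y are exactly the multiples of f, and L = K(x, y).  Such an L
   exists if and only if f generates a prime ideal. *)
Definition is_function_field (K L : fieldType) (iL : {rmorphism K -> L})
    (f : {poly {poly K}}) (x y : L) : Prop :=
  (forall P : {poly {poly K}},
     eval2 iL x y P = 0 <-> exists Q : {poly {poly K}}, P = Q * f) /\
  (forall z : L, exists P Q : {poly {poly K}},
     eval2 iL x y Q <> 0 /\ z = eval2 iL x y P / eval2 iL x y Q).

Definition is_automorphism_over (K L : fieldType) (iL : {rmorphism K -> L})
    (g : {rmorphism L -> L}) : Prop :=
  bijective g /\ forall c : K, g (iL c) = iL c.

(* Nonnegative powers suffice to form the group generated by h only when h has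
   finite order. *)
Definition cyclic_group (L : Type) (h : L -> L) : set (L -> L) :=
  [set g | exists k : nat, g = iter k h]%classic.

Definition fixed_field (L : Type) (H : set (L -> L)) : set L :=
  [set z | forall g, H g -> g z = z]%classic.

(* A ring morphism between fields is injective, so phi is an isomorphism over K
   from M onto the subfield E of L. *)
Definition isomorphic_over_to_subfield (K L M : fieldType)
    (iL : {rmorphism K -> L}) (iM : {rmorphism K -> M}) (E : set L) : Prop :=
  exists phi : {rmorphism M -> L},
    (forall c : K, phi (iM c) = iL c) /\ range phi = E.

(* Main.v *)
Require Import Defs.
From HB Require Import structures.
From mathcomp Require Import all_boot all_order all_algebra.
From mathcomp Require Import boolp classical_sets functions cardinality.
From mathcomp Require Import zify ring.

Set Implicit Arguments.
Unset Strict Implicit.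
Unset Printing Implicit Defensive.

Import GRing.Theory.
Local Open Scope ring_scope.

(** Write s = p^i, so that q = s^2, and put n = s^2 - s + 1 and
m = s^2 + s + 1, so that m * n = q^2 + q + 1.  Then mu = lambda^m is a
primitive n-th root of unity, h = alpha^m multiplies x by mu, and it multiplies
y by mu^s, because s^2 + 1 = s modulo n.

Dividing the equation of X_q by y gives A + B + 1 = 0 with the monomials
A = x^q y^(-q-1) and B = x^(-1) y^(-q); the curve is thus a Kummer cover of a
line, described by the lattice of all monomials over the one spanned by A and
B.  The monomials fixed by h form a lattice in between, and the cover of the
line that it describes is X_s with the roles of A and B exchanged.  Solving
u^s v^(-s-1) = B and u^(-1) v^(-s) = A for u and v gives
   u |-> y / x^s,    v |-> y^s / x^(s-1).
These two functions satisfy the equation of X_s ([quotient_coord_relation]) and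
are fixed by h.

They define a morphism phi from K(u, v) to K(x, y) as soon as a polynomial that
does not vanish at (u, v) does not vanish at their images.  Such a polynomial P
is invertible modulo the equation f of X_s, up to a nonzero polynomial c in v
alone ([function_field_eval_invertible_mod], by resultants); so it is enough
that the image of v is transcendental over K
([quotient_coord_transcendental]).

It remains to see that every z fixed by h lies in the image E of phi.  Since
y = u x^s and x^n = v / u^s, the field K(x, y) is obtained from E by adjoining
x, whose n-th power is in E.  As h multiplies x by mu, averaging a polynomial in
x over the powers of h leaves only the powers of x^n ([range_horner_fixed]), and
fractions reduce to polynomials by taking the norm of the denominator
([range_quotient_fixed]). *)

(** * Evaluation of bivariate polynomials *)

Section Eval2.
Variables (K L : fieldType) (iL : {rmorphism K -> L}) (x y : L).

Fact eval2_is_zmod_morphism : zmod_morphism (eval2 iL x y).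
Proof. by move=> P Q; rewrite /eval2 rmorphB !hornerE. Qed.

Fact eval2_is_monoid_morphism : monoid_morphism (eval2 iL x y).
Proof.
by split=> [|P Q]; rewrite /eval2 ?rmorph1 ?rmorphM ?hornerM ?hornerC.
Qed.

HB.instance Definition _ :=
  GRing.isZmodMorphism.Build _ _ (eval2 iL x y) eval2_is_zmod_morphism.
HB.instance Definition _ :=
  GRing.isMonoidMorphism.Build _ _ (eval2 iL x y) eval2_is_monoid_morphism.

Lemma eval2B P Q : eval2 iL x y (P - Q) = eval2 iL x y P - eval2 iL x y Q.
Proof. exact: rmorphB. Qed.

Lemma eval2M P Q : eval2 iL x y (P * Q) = eval2 iL x y P * eval2 iL x y Q.
Proof. exact: rmorphM. Qed.

Lemma eval2X : eval2 iL x y 'X = x.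
Proof. by rewrite /eval2 map_polyX hornerX hornerC. Qed.

Lemma eval2Xn (k : nat) : eval2 iL x y 'X^k = x ^+ k.
Proof. by rewrite /eval2 map_polyXn hornerXn -rmorphXn hornerC. Qed.

Lemma eval2C (c : {poly K}) : eval2 iL x y c%:P = (map_poly iL c).[y].
Proof. by rewrite /eval2 map_polyC hornerC. Qed.

Lemma eval2Y : eval2 iL x y 'Y = y.
Proof. by rewrite eval2C map_polyX hornerX. Qed.

Lemma eval2_pellikaan (r : nat) :
  eval2 iL x y (pellikaan K r) = x * y ^+ r.+1 + x ^+ r.+1 + y.
Proof. by rewrite !rmorphD rmorphM !rmorphXn /= eval2X eval2Y. Qed.

End Eval2.

Lemma rmorph_eval2 (K L M : fieldType) (iL : {rmorphism K -> L})
    (iM : {rmorphism K -> M}) (g : {rmorphism L -> M}) (x y : L)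
    (P : {poly {poly K}}) :
    (forall c, g (iL c) = iM c) ->
  g (eval2 iL x y P) = eval2 iM (g x) (g y) P.
Proof.
move=> gK; rewrite /eval2 -horner_map.
rewrite -(horner_map (map_poly g)) /= map_polyC -map_poly_comp.
congr (_.[_].[_]); apply: eq_map_poly => c /=.
by rewrite -map_poly_comp; apply: eq_map_poly => d /=.
Qed.

Lemma eval2_closed (K L : fieldType) (iL : {rmorphism K -> L}) (x y : L)
    (S : L -> Prop) :
    (forall a b, S a -> S b -> S (a + b)) ->
    (forall a b, S a -> S b -> S (a * b)) ->
    (forall c, S (iL c)) -> S x -> S y ->
  forall P, S (eval2 iL x y P).
Proof.
move=> SD SM SK Sx Sy; elim/poly_ind => [|P c IH].
  by rewrite rmorph0 -(rmorph0 iL).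
rewrite rmorphD rmorphM /= eval2X; apply/SD; first exact: SM.
elim/poly_ind: c => [|c d IHc]; first by rewrite rmorph0 -(rmorph0 iL).
rewrite !rmorphD !rmorphM /= eval2Y; apply/SD; first exact: SM.
by rewrite eval2C map_polyC hornerC; exact: SK.
Qed.

(** * Morphisms out of a function field *)

Section FunctionField.
Variables (K L : fieldType) (iL : {rmorphism K -> L}) (x y : L).
Variable f : {poly {poly K}}.
Hypothesis Lf : is_function_field iL f x y.

Lemma function_field_eval0 : eval2 iL x y f = 0.
Proof. by apply/Lf.1; exists 1; rewrite mul1r. Qed.

Lemma function_field_eval_neq0 (P : {poly {poly K}}) :
  P != 0 -> (size P < size f)%N -> eval2 iL x y P != 0.
Proof.
move=> P0 ltPf; apply/eqP => /Lf.1 [Q PQf]; move: P0 ltPf; rewrite PQf.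
rewrite mulf_eq0 negb_or => /andP[Q0 f0]; rewrite size_mul //.
by move: Q0; rewrite -size_poly_gt0; move: (size Q) (size f) => m n; lia.
Qed.

Lemma function_field_rmorph_inj (N : fieldType) (g1 g2 : {rmorphism L -> N}) :
    (forall c, g1 (iL c) = g2 (iL c)) -> g1 x = g2 x -> g1 y = g2 y ->
  g1 =1 g2.
Proof.
move=> eqK eqx eqy z; have [P [Q [_ ->]]] := Lf.2 z.
pose iN := (g1 \o iL : {rmorphism K -> N}).
by rewrite !fmorph_div !(@rmorph_eval2 _ _ _ _ iN) ?eqx ?eqy // => c;
  rewrite /= eqK.
Qed.

(** The ideal (f) is prime, being the kernel of the evaluation at (x, y).  If
the resultant of P and f with respect to the outer variable vanished, f would be,
up to a factor in the inner variable, a product R * g with g a common factor of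
positive degree; R has smaller degree than f and cannot vanish at (x, y), so g
vanishes there, and so does P. *)
Lemma function_field_eval_invertible_mod (P : {poly {poly K}}) :
    (1 < size f)%N -> eval2 iL x y P != 0 ->
  exists (c : {poly K}) (U V : {poly {poly K}}),
    c != 0 /\ c%:P = U * P + V * f.
Proof.
move=> f1 P0.
have [sP|P1] := leqP (size P) 1.
  have PC := size1_polyC sP.
  exists P`_0, 1, 0; rewrite mul0r addr0 mul1r -PC; split=> //.
  by apply: contra_neq P0 => c0; rewrite PC c0 polyC0 rmorph0.
have [/eqP r0|r0] := boolP (resultant P f == 0); last first.
  have [[U V] _ e] := resultant_in_ideal P1 f1.
  by exists (resultant P f), U, V.
exfalso; move/eqP: r0; rewrite resultant_eq0.
set g := Pdiv.Idomain.gcdp P f => g1.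
have /Pdiv.Idomain.dvdpP [[c Q] /= c0 cP] := Pdiv.Idomain.dvdp_gcdl P f.
have /Pdiv.Idomain.dvdpP [[d R] /= d0 df] := Pdiv.Idomain.dvdp_gcdr P f.
rewrite -/g in cP df.
have f0 : f != 0 by rewrite -size_poly_gt0; lia.
have sz (a : {poly K}) : a != 0 -> eval2 iL x y a%:P != 0.
  move=> a0; apply: function_field_eval_neq0; rewrite ?polyC_eq0 //.
  by rewrite size_polyC a0; lia.
have R0 : R != 0.
  apply/eqP => R0; move/eqP: df; rewrite R0 mul0r scale_poly_eq0.
  by rewrite (negPf d0) (negPf f0).
have g0 : g != 0 by rewrite -size_poly_gt0; lia.
have eR : eval2 iL x y R != 0.
  apply: function_field_eval_neq0 => //.
  rewrite -(size_scale f d0) df size_mul //.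
  by move: (size R) (size g) g1 => m n; lia.
have eg : eval2 iL x y g = 0.
  have : eval2 iL x y (R * g) = 0.
    by rewrite -df -mul_polyC rmorphM /= function_field_eval0 mulr0.
  by move/eqP; rewrite rmorphM mulf_eq0 (negPf eR) /= => /eqP.
move/(congr1 (eval2 iL x y)): cP => /eqP.
rewrite -mul_polyC !rmorphM /= eg mulr0 mulf_eq0 (negPf P0).
by rewrite (negPf (sz c c0)).
Qed.

Section Extension.
Variables (N : fieldType) (iN : {rmorphism K -> N}) (x' y' : N).
Hypothesis fxy' : eval2 iN x' y' f = 0.
Hypothesis f_gt1 : (1 < size f)%N.
Hypothesis y'_tr : forall c : {poly K}, c != 0 -> (map_poly iN c).[y'] != 0.

Lemma eval_transfer0 (P : {poly {poly K}}) :
  eval2 iL x y P = 0 -> eval2 iN x' y' P = 0.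
Proof. by move=> /Lf.1 [Q ->]; rewrite eval2M /= fxy' mulr0. Qed.

(** If c = U * P + V * f with c <> 0 a polynomial in y' alone, a zero of P at
(x', y') would be an algebraic relation for y'. *)
Lemma eval_transfer_neq0 (P : {poly {poly K}}) :
  eval2 iL x y P != 0 -> eval2 iN x' y' P != 0.
Proof.
move=> /(function_field_eval_invertible_mod f_gt1) [c [U [V [c0 e]]]].
apply: contra_neq (y'_tr c0) => P0.
by rewrite -(eval2C _ x') e rmorphD /= !eval2M P0 fxy' !mulr0 addr0.
Qed.

(** A point of the curve f = 0 whose second coordinate is transcendental is a
generic point, so fractions can be evaluated at it. *)
Lemma function_field_rmorph_exists :
  exists phi : {rmorphism L -> N},
    [/\ forall c, phi (iL c) = iN c, phi x = x' & phi y = y'].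
Proof.
have /choice[num /choice[den frac]] := Lf.2.
pose phi z := eval2 iN x' y' (num z) / eval2 iN x' y' (den z).
have phiE P Q : eval2 iL x y Q != 0 ->
    phi (eval2 iL x y P / eval2 iL x y Q)
      = eval2 iN x' y' P / eval2 iN x' y' Q.
  move=> Q0; have : eval2 iL x y P / eval2 iL x y Q * eval2 iL x y Q
                    = eval2 iL x y P by rewrite divfK.
  rewrite /phi; move: (eval2 iL x y P / _) => z zQ.
  have [/eqP d0 zE] := frac z.
  have zD : z * eval2 iL x y (den z) = eval2 iL x y (num z).
    by rewrite {1}zE divfK.
  have e : eval2 iL x y (num z * Q - P * den z) = 0.
    by rewrite eval2B !eval2M /= -zD -zQ mulrAC subrr.
  apply/eqP; rewrite eqr_div ?eval_transfer_neq0 // -!eval2M -subr_eq0.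
  by rewrite -eval2B eval_transfer0.
have phiE1 P : phi (eval2 iL x y P) = eval2 iN x' y' P.
  have := phiE P 1; rewrite !rmorph1 !divr1; apply; exact: oner_neq0.
have phiB : zmod_morphism phi.
  move=> z1 z2; have [/eqP d1 e1] := frac z1; have [/eqP d2 e2] := frac z2.
  have d12 : eval2 iL x y (den z1 * den z2) != 0 by rewrite eval2M mulf_neq0.
  have -> : z1 - z2 = eval2 iL x y (num z1 * den z2 - num z2 * den z1)
      / eval2 iL x y (den z1 * den z2).
    by rewrite {1}e1 {1}e2 -mulNr addf_div // mulNr eval2B !eval2M.
  rewrite (phiE _ _ d12) eval2B !eval2M /= /phi -[in RHS]mulNr.
  by rewrite addf_div ?eval_transfer_neq0 // mulNr.
have phiM : monoid_morphism phi.
  split=> [|z1 z2]; first by rewrite -(rmorph1 (eval2 iL x y)) phiE1 rmorph1.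
  have [/eqP d1 e1] := frac z1; have [/eqP d2 e2] := frac z2.
  have d12 : eval2 iL x y (den z1 * den z2) != 0 by rewrite eval2M mulf_neq0.
  have -> : z1 * z2 = eval2 iL x y (num z1 * num z2)
      / eval2 iL x y (den z1 * den z2).
    by rewrite {1}e1 {1}e2 mulf_div !eval2M.
  by rewrite (phiE _ _ d12) !eval2M /= /phi mulf_div.
pose phiB' := GRing.isZmodMorphism.Build _ _ phi phiB.
pose phiM' := GRing.isMonoidMorphism.Build _ _ phi phiM.
pose phi' : {rmorphism L -> N} := HB.pack phi phiB' phiM'.
exists phi'; split=> [c||] /=.
- have := phiE1 c%:P%:P; rewrite !eval2C !map_polyC !hornerC; exact.
- by have := phiE1 'X; rewrite !eval2X.
- by have := phiE1 'Y; rewrite !eval2Y.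
Qed.

End Extension.
End FunctionField.

(** * Iterates of an endomorphism *)

Lemma iter_rmorphism (L : nzRingType) (g : {rmorphism L -> L}) (k : nat) :
  exists h : {rmorphism L -> L}, h = iter k g :> (L -> L).
Proof.
elim: k => [|k [h hE]]; first by exists idfun.
by exists (g \o h : {rmorphism L -> L}); apply/funext => z /=; rewrite hE.
Qed.

Lemma iter_eigen (L : nzRingType) (g : {rmorphism L -> L}) (c x : L) (k : nat) :
  g c = c -> g x = c * x -> iter k g x = c ^+ k * x.
Proof.
move=> gc gx; elim: k => [|k IH] /=; first by rewrite mul1r.
by rewrite IH rmorphM rmorphXn /= gc gx mulrA exprSr.
Qed.

Lemma iter_fixed (T : Type) (g : T -> T) (x : T) (k : nat) :
  g x = x -> iter k g x = x.
Proof. by move=> gx; elim: k => //= k ->. Qed.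

Lemma cyclic_group_card (T : Type) (h : T -> T) (n : nat) (x : T) :
    (0 < n)%N -> (forall z, iter n h z = z) ->
    (forall j k, (j < n)%N -> (k < n)%N -> iter j h x = iter k h x -> j = k) ->
  (cyclic_group h #= `I_n)%card.
Proof.
move=> n_gt0 h_order h_inj.
have -> : cyclic_group h = ((fun k => iter k h) @` `I_n)%classic.
  apply/seteqP; split=> g [k]; last by move=> _ <-; exists k.
  move=> ->; exists (k %% n)%N; first exact: ltn_pmod.
  apply/funext => z; rewrite {2}(divn_eq k n) addnC iterD; congr (iter _ h _).
  by elim: (k %/ n)%N => //= j IH; rewrite mulSn iterD -IH h_order.
apply: inj_card_eq => j k; rewrite !in_setE /= => jn kn jk.
by apply: h_inj => //; rewrite jk.
Qed.

(** * Kummer descent *)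

Lemma sum_prim_root_powers (L : idomainType) (n : nat) (zeta : L) (j : nat) :
  n.-primitive_root zeta -> ~~ (n %| j)%N -> \sum_(k < n) (zeta ^+ j) ^+ k = 0.
Proof.
move=> zP nj; have z1 : zeta ^+ j - 1 != 0.
  by rewrite subr_eq0 -(prim_order_dvd zP).
apply: (mulfI z1); rewrite mulr0 -subrX1 -exprM mulnC exprM.
by rewrite (prim_expr_order zP) expr1n subrr.
Qed.

Section KummerDescent.
Variables (M L : fieldType) (phi : {rmorphism M -> L}) (h : {rmorphism L -> L}).
Variables (n : nat) (zeta : M) (x : L).
Hypothesis zeta_prim : n.-primitive_root zeta.
Hypothesis h_phi : forall m, h (phi m) = phi m.
Hypothesis h_x : h x = phi zeta * x.
Hypothesis xn_in : exists m, x ^+ n = phi m.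

Let zetaL_prim : n.-primitive_root (phi zeta).
Proof. by rewrite fmorph_primitive_root. Qed.

Lemma iter_horner (k : nat) (p : {poly M}) :
  iter k h (map_poly phi p).[x] = (map_poly phi p).[phi zeta ^+ k * x].
Proof.
have [hk hkE] := iter_rmorphism h k; rewrite -hkE -horner_map -map_poly_comp.
rewrite hkE (iter_eigen _ (h_phi zeta) h_x); congr (_.[_]).
by apply: eq_map_poly => m /=; rewrite hkE iter_fixed.
Qed.

Lemma iter_horner_order (p : {poly M}) :
  iter n h (map_poly phi p).[x] = (map_poly phi p).[x].
Proof. by rewrite iter_horner (prim_expr_order zetaL_prim) mul1r. Qed.

(** Summing the n iterates of h kills the terms in x^j with j not divisible by
n and multiplies the others, which are in the image of phi, by n; and n is
invertible because there is a primitive n-th root of unity. *)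
Lemma range_horner_fixed (p : {poly M}) :
    h (map_poly phi p).[x] = (map_poly phi p).[x] ->
  exists m, phi m = (map_poly phi p).[x].
Proof.
move=> hp; have n0 := prim_root_natf_neq0 zetaL_prim.
have [a xnE] := xn_in.
exists (\sum_(j < size p | (n %| j)%N) p`_j * a ^+ (j %/ n)).
apply: (mulfI n0); transitivity (\sum_(k < n) iter k h (map_poly phi p).[x]).
  under [RHS]eq_bigr do rewrite iter_horner horner_coef size_map_poly.
  rewrite [RHS]exchange_big rmorph_sum big_mkcond mulr_sumr /=.
  apply: eq_bigr => j _; rewrite coef_map /=.
  under [RHS]eq_bigr do rewrite exprMn mulrCA -exprM mulnC exprM.
  rewrite -mulr_suml; case: ifPn => nj; last first.
    by rewrite (sum_prim_root_powers zetaL_prim nj) mul0r mulr0.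
  have /eqP -> : phi zeta ^+ j == 1 by rewrite -(prim_order_dvd zetaL_prim).
  under eq_bigr do rewrite expr1n.
  rewrite sumr_const card_ord rmorphM rmorphXn /= -xnE -exprM mulnC divnK //.
under eq_bigr do rewrite iter_fixed //.
by rewrite sumr_const card_ord mulr_natl.
Qed.

(** Multiplying numerator and denominator by the conjugates of the denominator
makes the denominator a norm, which is fixed by h; the numerator is then fixed
too, and both are polynomials in x. *)
Lemma range_quotient_fixed (a b : {poly M}) :
    (map_poly phi b).[x] != 0 ->
    h ((map_poly phi a).[x] / (map_poly phi b).[x])
      = (map_poly phi a).[x] / (map_poly phi b).[x] ->
  exists m, phi m = (map_poly phi a).[x] / (map_poly phi b).[x].
Proof.
set A := (map_poly phi a).[x]; set B := (map_poly phi b).[x] => B0 hz.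
have n0 := prim_order_gt0 zeta_prim.
pose adj w := exists p : {poly M}, w = (map_poly phi p).[x].
have adjM v w : adj v -> adj w -> adj (v * w).
  by move=> [c ->] [d ->]; exists (c * d); rewrite rmorphM hornerM.
have adj_iter k : adj (iter k h B).
  exists (b \Po (zeta ^+ k *: 'X)).
  rewrite iter_horner map_comp_poly horner_comp map_polyZ map_polyX.
  by rewrite !hornerE rmorphXn.
have adj_fixed w : adj w -> h w = w -> exists m, phi m = w.
  by move=> [c ->]; exact: range_horner_fixed.
pose N := \prod_(k < n) iter k h B.
have adj1 : adj 1 by exists 1; rewrite rmorph1 hornerC.
have hN : h N = N.
  apply: (mulfI B0); rewrite rmorph_prod /= -[RHS]mulrC.
  transitivity (\prod_(k < n.+1) iter k h B); first by rewrite big_ord_recl.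
  by rewrite big_ord_recr /= iter_horner_order.
have NE : N = B * \prod_(k < n.-1) iter k.+1 h B.
  by rewrite /N -(prednK n0) big_ord_recl.
have N0 : N != 0.
  apply/prodf_neq0 => k _; have [hk <-] := iter_rmorphism h k.
  by rewrite fmorph_eq0.
have [d dN] : exists m, phi m = N.
  by apply: adj_fixed => //; apply: (big_ind adj adj1 adjM).
have [c cN] : exists m, phi m = A / B * N.
  apply: adj_fixed; last by rewrite rmorphM /= hz hN.
  rewrite NE mulrA divfK //; apply/adjM; first by exists a.
  by apply: (big_ind adj adj1 adjM) => k _; exact: (adj_iter k.+1).
by exists (c / d); rewrite fmorph_div cN dN mulfK.
Qed.

End KummerDescent.

(** * Pellikaan curves and the coordinates of the quotient *)

Lemma size_pellikaan (K : fieldType) (r : nat) :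
  (0 < r)%N -> size (pellikaan K r) = r.+2.
Proof.
move=> r0; rewrite /pellikaan -addrA addrC -addrA size_polyDl ?size_polyXn //.
apply: (leq_ltn_trans (size_polyD _ _)); rewrite gtn_max ltnS.
apply/andP; split; first by rewrite (leq_trans (size_polyC_leq1 _)).
rewrite -rmorphXn /= mulrC mul_polyC.
apply: (leq_ltn_trans (size_scale_leq _ _)).
by rewrite size_polyX.
Qed.

Lemma pellikaan_coord_neq0 (K L : fieldType) (iL : {rmorphism K -> L})
    (x y : L) (r : nat) :
    (0 < r)%N -> is_function_field iL (pellikaan K r) x y ->
  x != 0 /\ y != 0.
Proof.
move=> r0 Lf; rewrite -{1}(eval2X iL x y) -{2}(eval2Y iL x y).
split; apply: (function_field_eval_neq0 Lf); rewrite ?size_pellikaan //.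
- by rewrite polyX_eq0.
- by rewrite size_polyX.
- by rewrite polyC_eq0 polyX_eq0.
- by rewrite (leq_ltn_trans (size_polyC_leq1 _)).
Qed.

Lemma closed_field_transcendental (K : closedFieldType) (L : fieldType)
    (iL : {rmorphism K -> L}) (z : L) :
    (forall a, z != iL a) ->
  forall c : {poly K}, c != 0 -> (map_poly iL c).[z] != 0.
Proof.
move=> zK c c0; have [rs ->] := closed_field_poly_normal c.
rewrite map_polyZ hornerZ mulf_neq0 ?fmorph_eq0 ?lead_coef_eq0 //.
rewrite rmorph_prod horner_prod prodf_seq_neq0; apply/allP => a _ /=.
by rewrite map_polyXsubC hornerXsubC subr_eq0 zK.
Qed.

Section Quotient.
Variables (K : closedFieldType) (s : nat).
Hypothesis s_gt1 : (1 < s)%N.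
Variables (L : fieldType) (iL : {rmorphism K -> L}) (x y : L).
Hypothesis Lf : is_function_field iL (pellikaan K (s ^ 2)) x y.

Let s2_gt0 : (0 < s ^ 2)%N. Proof. by rewrite expn_gt0 ltnW. Qed.
Let x0 : x != 0. Proof. by case: (pellikaan_coord_neq0 s2_gt0 Lf). Qed.
Let y0 : y != 0. Proof. by case: (pellikaan_coord_neq0 s2_gt0 Lf). Qed.

(** The left-hand side is the equation of the large curve multiplied by the
monomial y^s / x^(s^2 + s). *)
Lemma quotient_coord_relation :
  eval2 iL (y / x ^+ s) (y ^+ s / x ^+ s.-1) (pellikaan K s) = 0.
Proof.
have xyE := function_field_eval0 Lf; rewrite eval2_pellikaan in xyE.
rewrite eval2_pellikaan.
(* With t = x^(s-1), every power of x at hand is a monomial in x, t and t^s. *)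
have xsE : x ^+ s = x * x ^+ s.-1 by rewrite -exprS prednK // ltnW.
have [xs0 ys0] : x ^+ s.-1 != 0 /\ y ^+ s != 0 by rewrite !expf_neq0.
have xq0 : (x ^+ s.-1) ^+ s != 0 by rewrite expf_neq0.
transitivity (y ^+ s / (x ^+ 2 * (x ^+ s.-1) ^+ 2 * (x ^+ s.-1) ^+ s)
   * (x * y ^+ (s ^ 2).+1 + x ^+ (s ^ 2).+1 + y)); last by rewrite xyE mulr0.
rewrite ![_ ^+ _.+1]exprS -mulnn !exprM !expr_div_n xsE exprMn xsE.
by field; rewrite x0 xs0 xq0.
Qed.

(** A constant value a would give the relation y^s = a x^(s-1), whose degree in
x is smaller than that of the equation of the curve. *)
Lemma quotient_coord_transcendental (c : {poly K}) :
  c != 0 -> (map_poly iL c).[y ^+ s / x ^+ s.-1] != 0.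
Proof.
apply: closed_field_transcendental => a.
pose P : {poly {poly K}} := ('X ^+ s)%:P - a%:P *: 'X^(s.-1).
have P0 : P != 0.
  apply/eqP => /(congr1 (fun Q : {poly {poly K}} => Q`_0)).
  rewrite coefB coefC coefZ coefXn coef0 /= eq_sym gtn_eqF ?ltn_predRL //.
  by move/eqP; rewrite mulr0 subr0 expf_eq0 polyX_eq0 andbF.
have sP : (size P < size (pellikaan K (s ^ 2)))%N.
  rewrite size_pellikaan // (leq_ltn_trans (size_polyD _ _)) //.
  rewrite size_polyN gtn_max (leq_ltn_trans (size_polyC_leq1 _)) //=.
  rewrite (leq_ltn_trans (size_scale_leq _ _)) // size_polyXn.
  by rewrite -mulnn; nia.
have := function_field_eval_neq0 Lf P0 sP; apply: contra_neq => ya.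
have xs0 : x ^+ s.-1 != 0 by rewrite expf_neq0.
rewrite eval2B -mul_polyC eval2M !eval2C map_polyXn map_polyC hornerXn hornerC.
by rewrite eval2Xn /= -ya divfK ?subrr.
Qed.

End Quotient.

(** * The quotient of the Pellikaan curve *)

Theorem theorem5p3 (p i q : nat) (p_prime : prime p) (i_ge1 : (1 <= i)%N)
    (q_def : q = (p ^ (2 * i))%N)
    (* K is the algebraic closure of F_q *)
    (F : finFieldType) (cardF : #|F| = q)
    (K : closedFieldType) (iF : {rmorphism F -> K})
    (K_closure : is_algebraic_closure iF)
    (* L = K(x, y) is the function field of X_q *)
    (L : fieldType) (iL : {rmorphism K -> L}) (x y : L)
    (L_funfield : is_function_field iL (pellikaan K q) x y)
    (lambda : K) (lambda_prim : (q ^ 2 + q + 1)%N.-primitive_root lambda)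
    (alpha : {rmorphism L -> L})
    (alpha_aut : is_automorphism_over iL alpha)
    (alpha_x : alpha x = iL lambda * x)
    (alpha_y : alpha y = iL (lambda ^+ (q + 1)) * y)
    (* M = K(u, v) is the function field of X_(p^i) *)
    (M : fieldType) (iM : {rmorphism K -> M}) (u v : M)
    (M_funfield : is_function_field iM (pellikaan K (p ^ i)) u v) :
  let h : L -> L := iter (p ^ (2 * i) + p ^ i + 1) alpha in
  let H : set (L -> L) := cyclic_group h in
  (H #= `I_(p ^ (2 * i) - p ^ i + 1))%card /\
  isomorphic_over_to_subfield iL iM (fixed_field H).
Proof.
have s_gt1 : (1 < p ^ i)%N by rewrite -(exp1n i) ltn_exp2r // prime_gt1.
move: q_def; rewrite mulnC expnM; set s := (p ^ i)%N in s_gt1 M_funfield *.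
move=> qE.
rewrite {q cardF}qE in L_funfield lambda_prim alpha_y *.
set m := (s ^ 2 + s + 1)%N; set n := (s ^ 2 - s + 1)%N.
have mnE : ((s ^ 2) ^ 2 + s ^ 2 + 1 = m * n)%N.
  by rewrite /m /n -!mulnn; have := leq_mul s_gt1 (leqnn s); nia.
have n_gt0 : (0 < n)%N by rewrite /n addn1.
pose mu := lambda ^+ m.
have mu_prim : n.-primitive_root mu.
  have := dvdn_prim_root lambda_prim (_ : (n %| _)%N).
  by rewrite mnE mulnK //; apply; exact: dvdn_mull.
have alpha_K := alpha_aut.2.
have [h hE] := iter_rmorphism alpha m; rewrite /= -hE.
have h_K c : h (iL c) = iL c by rewrite hE iter_fixed.
have h_x : h x = iL mu * x.
  by rewrite hE (iter_eigen _ (alpha_K lambda) alpha_x) rmorphXn.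
have h_y : h y = iL (mu ^+ s) * y.
  rewrite hE (iter_eigen _ (alpha_K (lambda ^+ (s ^ 2 + 1))) alpha_y).
  rewrite -!rmorphXn.
  congr (iL _ * _); apply/eqP; rewrite -!exprM (eq_prim_root_expr lambda_prim).
  (* Here s^2 + 1 = n + s is used; m n is the order of lambda. *)
  have -> : ((s ^ 2 + 1) * m = m * n + m * s)%N.
    by rewrite /n -!mulnn; have := leq_mul s_gt1 (leqnn s); nia.
  by rewrite mnE modnDl.
have [x0 y0] : x != 0 /\ y != 0.
  by apply: (pellikaan_coord_neq0 _ L_funfield); rewrite expn_gt0 ltnW.
have s_gt0 := ltnW s_gt1.
have h_iter_x k : iter k h x = iL (mu ^+ k) * x.
  by rewrite (iter_eigen _ (h_K mu) h_x) rmorphXn.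
have h_order z : iter n h z = z.
  have [hn hnE] := iter_rmorphism h n; rewrite -hnE.
  apply: (function_field_rmorph_inj L_funfield (g2 := idfun)) => [c||] /=;
    rewrite hnE.
  - exact: iter_fixed.
  - by rewrite h_iter_x (prim_expr_order mu_prim) rmorph1 mul1r.
  - rewrite (iter_eigen _ (h_K (mu ^+ s)) h_y) -rmorphXn -exprM mulnC exprM.
    by rewrite (prim_expr_order mu_prim) expr1n rmorph1 mul1r.
split.
  apply: (cyclic_group_card (x := x)) => // j k jn kn.
  rewrite !h_iter_x => /(mulIf x0)/fmorph_inj/eqP.
  by rewrite (eq_prim_root_expr mu_prim) !modn_small // => /eqP.
have f_gt1 : (1 < size (pellikaan K s))%N by rewrite size_pellikaan.
have [phi [phi_K phi_u phi_v]] :=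
  function_field_rmorph_exists M_funfield
    (quotient_coord_relation s_gt1 L_funfield) f_gt1
    (quotient_coord_transcendental s_gt1 L_funfield).
have s2E : (s * s = n + s.-1)%N by rewrite /n -mulnn; nia.
have xs0 k : x ^+ k != 0 by rewrite expf_neq0.
have mu0 : iL mu != 0.
  rewrite fmorph_eq0; apply/eqP => mu0; move: (prim_expr_order mu_prim) => /eqP.
  by rewrite mu0 expr0n gtn_eqF // eq_sym oner_eq0.
have h_phi w : h (phi w) = phi w.
  apply: (function_field_rmorph_inj M_funfield (g1 := h \o phi)) => [c||] /=.
  - by rewrite phi_K.
  - rewrite phi_u fmorph_div rmorphXn /= h_x h_y exprMn rmorphXn /=.
    by rewrite -mulf_div divff ?mul1r // expf_neq0.
  - rewrite phi_v fmorph_div !rmorphXn /= h_x h_y !exprMn -rmorphXn -exprM.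
    rewrite s2E exprD (prim_expr_order mu_prim) mul1r rmorphXn /=.
    by rewrite -mulf_div divff ?mul1r // expf_neq0.
exists phi; split=> //; apply/seteqP; split=> z.
  by move=> [w _ <-] g [k ->]; exact: iter_fixed.
move=> /(_ h (ex_intro _ 1%N erefl)) hz.
have xn_in : exists w, x ^+ n = phi w.
  exists (v / u ^+ s); rewrite fmorph_div rmorphXn phi_u phi_v.
  rewrite expr_div_n -exprM s2E exprD.
  by field; rewrite !xs0 expf_neq0.
have adj P : exists a : {poly M}, eval2 iL x y P = (map_poly phi a).[x].
  apply: (eval2_closed (S := fun w => exists a, w = (map_poly phi a).[x])).
  - by move=> _ _ [a ->] [b ->]; exists (a + b); rewrite rmorphD hornerD.
  - by move=> _ _ [a ->] [b ->]; exists (a * b); rewrite rmorphM hornerM.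
  - by move=> c; exists (iM c)%:P; rewrite map_polyC hornerC /= phi_K.
  - by exists 'X; rewrite map_polyX hornerX.
  exists (u *: 'X^s).
  by rewrite map_polyZ map_polyXn hornerZ hornerXn phi_u divfK.
have [P [Q [/eqP Q0 zE]]] := L_funfield.2 z.
have [[a aE] [b bE]] := (adj P, adj Q).
move: hz Q0; rewrite {}zE aE bE => hz b0.
have zeta_prim : n.-primitive_root (iM mu) by rewrite fmorph_primitive_root.
have h_x' : h x = phi (iM mu) * x by rewrite phi_K.
have [w wE] := range_quotient_fixed zeta_prim h_phi h_x' xn_in b0 hz.
by exists w.
Qed.
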